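(* The expected rumor spreading time of the push protocol on the complete graph with $n$ vertices is $\log_2 n+\ln n\pm O(1)$.
   Context: Push protocol on the complete graph with $n$ nodes: initially exactly one node is informed. In each round, every node that was informed at the beginning of the round calls a node chosen independently and uniformly at random from all $n$ nodes (including itself) and sends it the rumor; called nodes are informed from the end of that round on. The rumor spreading time is the number of rounds until all nodes are informed. $\pm O(1)$ denotes a deviation bounded in absolute value by a constant independent of $n$, for all sufficiently large $n$. *)

(* Defs.v *)
From HB Require Import structures.
From mathcomp Require Import all_boot all_order all_algebra.
From mathcomp Require Import finmap.
From mathcomp Require Import all_classical all_reals all_analysis.

Set Implicit Arguments.
Unset Strict Implicit.
Unset Printing Implicit Defensive.

Import Order.TTheory GRing.Theory Num.Theory.

Local Open Scope classical_set_scope.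
Local Open Scope ring_scope.

(* [U] carries the discrete sigma-algebra, so every [A i : set U] is an event;
   this is meant for finite [U]. *)
Definition mutually_independent (R : realType) (d : measure_display)
    (Omega : measurableType d) (P : probability Omega R)
    (I : choiceType) (U : Type) (X : I -> Omega -> U) : Prop :=
  forall (J : {fset I}) (A : I -> set U),
    P (\bigcap_(i in [set` J]) (X i @^-1` A i)) =
    (\prod_(i <- J) P (X i @^-1` A i))%E.

(* [X (t, v)] is the node that [v] calls in the round leading from time [t] to
   time [t.+1]. It is defined for every [v], but only the calls of nodes already
   informed at time [t] are ever used, see [informed]. *)
Definition push_calls (R : realType) (d : measure_display)
    (Omega : measurableType d) (P : probability Omega R)
    (n : nat) (X : nat * 'I_n -> Omega -> 'I_n) : Prop :=
  [/\ forall (i : nat * 'I_n) (A : set 'I_n), measurable (X i @^-1` A),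
      forall (i : nat * 'I_n) (w : 'I_n),
        P (X i @^-1` [set w]) = (n%:R^-1)%:E
    & mutually_independent P X].

Fixpoint informed (n : nat) (call : nat * 'I_n -> 'I_n) (v0 : 'I_n) (t : nat)
    : {set 'I_n} :=
  if t is t'.+1 then
    informed call v0 t' :|:
      [set call (t', v) | v in informed call v0 t']%SET
  else [set v0]%SET.

(* Equal to +oo when some node is never informed. *)
Definition spreading_time (R : realType) (n : nat)
    (call : nat * 'I_n -> 'I_n) (v0 : 'I_n) : \bar R :=
  ereal_inf [set (t%:R)%:E | t in
    [set t : nat | forall v : 'I_n, v \in informed call v0 t]].

(* The library's ['E_P[_]] only takes real-valued random variables. *)
Definition expected_spreading_time (R : realType) (d : measure_display)
    (Omega : measurableType d) (P : probability Omega R)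
    (n : nat) (X : nat * 'I_n -> Omega -> 'I_n) (v0 : 'I_n) : \bar R :=
  (\int[P]_omega spreading_time R (fun i => X i omega) v0)%E.

Definition log2 (R : realType) (x : R) : R := ln x / ln 2.

(* Main.v *)
Require Import Defs.
From HB Require Import structures.
From mathcomp Require Import all_boot all_order all_algebra.
From mathcomp Require Import finmap.
From mathcomp Require Import all_classical all_reals all_analysis.
From mathcomp Require Import measurable_realfun ring lra.

Import Order.TTheory GRing.Theory Num.Theory.

Local Open Scope classical_set_scope.
Local Open Scope ring_scope.

(* The expected spreading time is the sum over t of the probability that some node
   is uninformed at time t. With k informed and u = n - k uninformed nodes, the
   number u' of uninformed nodes after one more round has mean
   m = u (1 - 1/n)^k and variance at most m. These two moments suffice to exhibit
   two potentials, both of the form log2 (n / k) + ln (u + 1) up to bounded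
   corrections, whose expectation in one round, as long as u > 0, drops by at least
   1, respectively by at most 1. Telescoping bounds the sum above by the initial
   values of the potentials, both of which are log2 n + ln n up to a constant. *)

(** * Logarithmic inequalities and potentials *)

Section Logarithm.
Context {R : realType}.
Implicit Types z s a M : R.

Lemma ln_le_sub1 z : 0 < z -> ln z <= z - 1.
Proof. by move=> z0; have := @le_ln1Dx R (z - 1); rewrite subrKC; apply; lra. Qed.

Lemma ln_ge_sub_inv z : 0 < z -> 1 - z^-1 <= ln z.
Proof.
move=> z0; have := @ln_le_sub1 z^-1; rewrite invr_gt0 => /(_ z0).
by rewrite lnV ?posrE//; lra.
Qed.

Lemma ln2_ge_half : 2^-1 <= ln 2 :> R.
Proof. by have := @ln_ge_sub_inv 2; lra. Qed.

(** Concavity of [ln]. Equality at [z = 2] matters: a round that doubles the informed set must count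
    as a full unit of [log2]. *)
Lemma ln_ge_chord z : 1 <= z <= 2 -> (z - 1) * ln 2 <= ln z.
Proof.
move=> /andP[z1 z2].
have t01 : (0 <= z - 1 <= 1)%R by apply/andP; split; lra.
have h := @concave_ln R (Itv01 (proj1 (andP t01)) (proj2 (andP t01))) 2 1
  (ltr0Sn R 1) ltr01.
move: h; rewrite !convRE /= ln1 mulr0 addr0.
by rewrite (_ : (z - 1) * 2 + _ = z)// /unstable.onem; ring.
Qed.

(* Applying [1 - 1/y <= ln y] to [y = sqrt z] keeps the blow-up of the quadratic
   error near [z = 0] down to [1 / sqrt z]. *)
Lemma ln_ge_quadratic z M : 0 < M -> M^-1 <= z ->
  (z - 1) - 2 * (z - 1) ^+ 2 * Num.sqrt M <= ln z.
Proof.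
move=> M0 Mz; have z0 : 0 < z by rewrite (lt_le_trans _ Mz)// invr_gt0.
have [s s0 [zE sM]] : exists2 s : R, 0 < s & z = s ^+ 2 /\ s^-1 <= Num.sqrt M.
  exists (Num.sqrt z); first by rewrite sqrtr_gt0.
  split; first by rewrite sqr_sqrtr// ltW.
  rewrite -sqrtrV ?(ltW z0)//; apply: ler_wsqrtr.
  by rewrite -[leRHS]invrK lef_pV2 ?posrE ?invr_gt0.
have lnzE : ln z = 2 * ln s by rewrite zE lnXn// mulr_natl.
have h1 := ln_ge_sub_inv _ s0.
have h2 : (z - 1) ^+ 2 * s^-1 <= (z - 1) ^+ 2 * Num.sqrt M.
  by apply: ler_wpM2l => //; exact: sqr_ge0.
suff h3 : s^-1 <= 1 - (z - 1) / 2 + (z - 1) ^+ 2 * s^-1 by lra.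
(* The difference vanishes doubly at [s = 1], hence the square; the cofactor is positive because
   [s > 0]. *)
rewrite -subr_ge0 (_ : _ - _ = s^-1 * (s - 1) ^+ 2 * (s * s + 3 / 2 * s)).
  apply: mulr_ge0; last by nra.
  by apply: mulr_ge0; [rewrite invr_ge0 ltW|exact: sqr_ge0].
rewrite zE; field; exact: lt0r_neq0.
Qed.

(** Convexity: the tangent error is a square over a positive number. Affine bounds are useful
    because their mean over a round only involves the mean of [u']. *)
Lemma inv_tangent s a : 0 < s -> 0 < a -> a^-1 - (s - a) / a ^+ 2 <= s^-1.
Proof.
move=> s0 a0; rewrite -subr_ge0.
rewrite (_ : _ - _ = (s - a) ^+ 2 / (s * a ^+ 2)).
  by rewrite divr_ge0 ?sqr_ge0 ?mulr_ge0 ?sqr_ge0 ?ltW.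
by field; rewrite ?lt0r_neq0.
Qed.

(** Convexity again; writing [a = b ^+ 2] and [s = r ^+ 2] makes the tangent error rational, with a
    double zero at [r = b]. *)
Lemma inv_sqrt_tangent s a : 0 < s -> 0 < a ->
  (Num.sqrt a)^-1 - (s - a) / (2 * a * Num.sqrt a) <= (Num.sqrt s)^-1.
Proof.
move=> s0 a0; set b := Num.sqrt a; set r := Num.sqrt s.
have b0 : 0 < b by rewrite sqrtr_gt0.
have r0 : 0 < r by rewrite sqrtr_gt0.
have -> : a = b ^+ 2 by rewrite sqr_sqrtr// ltW.
have -> : s = r ^+ 2 by rewrite sqr_sqrtr// ltW.
rewrite -subr_ge0 (_ : _ - _ = (r - b) ^+ 2 * (r + 2 * b) / (2 * b ^+ 3 * r)).
  apply: divr_ge0; first by apply: mulr_ge0; [exact: sqr_ge0|lra].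
  by apply: mulr_ge0; [apply: mulr_ge0; [lra|apply: exprn_ge0; lra]|lra].
by field; rewrite ?lt0r_neq0.
Qed.

Lemma ln_le_tangent a b : 0 < a -> 0 < b -> ln b <= ln a + (b - a) / a.
Proof.
move=> a0 b0; have := ln_le_sub1 _ (divr_gt0 b0 a0).
have -> : (b - a) / a = b / a - 1 by field; exact: lt0r_neq0.
by rewrite ln_div ?posrE//; lra.
Qed.

Lemma ln_ge_secant a b : 0 < a -> a <= b -> b <= 2 * a ->
  ln a + (b - a) / a * ln 2 <= ln b.
Proof.
move=> a0 ab b2a; have b0 : 0 < b by exact: lt_le_trans ab.
have h : 1 <= b / a <= 2 by rewrite ler_pdivlMr// mul1r ab ler_pdivrMr.
have := ln_ge_chord _ h.
have -> : (b - a) / a = b / a - 1 by field; exact: lt0r_neq0.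
by rewrite ln_div ?posrE//; lra.
Qed.

(** [ln_ge_quadratic] recentred at [a ^+ 2], with [M = a ^+ 2]. The hypothesis amounts to [1 <= b];
    it will be applied with [b = u' + 1] and [a ^+ 2 = m + 1]. *)
Lemma ln_ge_quadratic_at a b : 0 < a -> a ^- 2 <= b / a ^+ 2 ->
  ln (a ^+ 2) + (b - a ^+ 2) / a ^+ 2 - 2 * (b - a ^+ 2) ^+ 2 / a ^+ 3 <= ln b.
Proof.
move=> a0 h; have a2 : 0 < a ^+ 2 by rewrite exprn_gt0.
have b0 : 0 < b by rewrite -(pmulr_lgt0 _ (_ : 0 < (a ^+ 2)^-1)) ?invr_gt0//
  (lt_le_trans _ h)// invr_gt0.
have := ln_ge_quadratic _ _ a2 h.
rewrite sqrtr_sqr gtr0_norm// ln_div ?posrE//.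
have -> : b / a ^+ 2 - 1 = (b - a ^+ 2) / a ^+ 2 by field; exact: lt0r_neq0.
have -> : 2 * ((b - a ^+ 2) / a ^+ 2) ^+ 2 * a = 2 * (b - a ^+ 2) ^+ 2 / a ^+ 3.
  by field; exact: lt0r_neq0.
lra.
Qed.

End Logarithm.

(** * Drift of the two potentials as functions of a real variable *)

Section Potentials.
Context {R : realType}.
Implicit Types n u m k x : R.

(* [n] nodes in total, [u] of them uninformed. The main terms are the remaining
   times of the doubling phase and of the final phase; [4 * (u / n)] pays for the
   rounds in the middle, [5 / (u + 1)] for the [+ 1] inside the logarithm, and
   the constant makes the potential nonnegative. *)
Definition upper_potential n u : R :=
  (ln n - ln (n - u)) / ln 2 + ln (u + 1) - 5 / (u + 1) + 4 * (u / n) + 5.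

(* Here the square root pays for the fluctuations of [ln (u + 1)]; the constant
   makes the potential vanish at [u = 0]. *)
Definition lower_potential n u : R :=
  (ln n - ln (n - u)) / ln 2 + ln (u + 1) + 40 / Num.sqrt (u + 1)
  + 8 * ((n - u) / n) - 48.

Let ln2_gt0 : 0 < ln 2 :> R.
Proof. by have := @ln2_ge_half R; lra. Qed.

(** Since [ln (1 + x) <= x], the logarithmic decrease of the mean yields a polynomial inequality. *)
Lemma mul1D_le_of_ln x u m : 0 <= x -> 0 < u -> 0 < m -> ln m <= ln u - x ->
  m * (1 + x) <= u.
Proof.
move=> x0 u0 m0 h; have x1 : 0 < 1 + x by lra.
rewrite -ler_ln ?posrE ?mulr_gt0// lnM ?posrE//.
by have := @le_ln1Dx R x; lra.
Qed.

(** The [+ 1] inside the logarithm costs at most [(u - m) / ((u + 1) * m)], while [- 5 / (u + 1)]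
    gains [5 * (u - m) / ((u + 1) * (m + 1))]. The gain wins once [m + 1 <= 5 * m], that is
    [4^-1 <= m]. *)
Lemma ln_succ_drift u m : 0 < u -> 4^-1 <= m -> m <= u ->
  ln (m + 1) - 5 / (m + 1) - (ln (u + 1) - 5 / (u + 1)) <= ln m - ln u.
Proof.
move=> u0 m4 mu.
have m0 : 0 < m by lra.
have u1 : 0 < u + 1 by lra.
have m1 : 0 < m + 1 by lra.
have := ln_le_tangent _ _ (mulr_gt0 u1 m0) (mulr_gt0 m1 u0).
rewrite !lnM ?posrE// => h.
suff : ((m + 1) * u - (u + 1) * m) / ((u + 1) * m) <= 5 / (m + 1) - 5 / (u + 1) by lra.
rewrite -subr_ge0.
rewrite (_ : _ - _ = (u - m) * (4 * m - 1) / (m * (u + 1) * (m + 1))).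
  apply: divr_ge0; first by apply: mulr_ge0; lra.
  by rewrite ltW// !mulr_gt0.
by field; rewrite ?lt0r_neq0.
Qed.

(** Here [x] is the informed fraction. Colliding calls keep the first term from reaching [- 1]; the
    term with factor 4 reduces the deficit to [x], which the decrease [ln m - ln u <= - x] then
    covers. *)
Lemma doubling_drift n x m : 0 < n -> 0 < x -> x < 1 -> m * (1 + x) <= n * (1 - x) ->
  (m - n * (1 - x)) / (n * x) + 4 * ((m - n * (1 - x)) / n) <= - 1 + x.
Proof.
move=> n0 x0 x1 gap; have x'0 : 0 < 1 + x by lra.
have nx0 : 0 < n * x by rewrite mulr_gt0.
have -> : (m - n * (1 - x)) / (n * x) + 4 * ((m - n * (1 - x)) / n)
    = (m - n * (1 - x)) * (1 + 4 * x) / (n * x).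
  by field; rewrite ?lt0r_neq0.
rewrite ler_pdivrMr//.
have mE : m <= n * (1 - x) / (1 + x) by rewrite ler_pdivlMr.
apply: (@le_trans _ _ ((n * (1 - x) / (1 + x) - n * (1 - x)) * (1 + 4 * x))).
  by rewrite ler_pM2r; lra.
rewrite -subr_ge0 (_ : _ - _ = n * x * (x * (3 * (1 - x))) / (1 + x)).
  apply: divr_ge0; last exact: ltW.
  by apply: mulr_ge0; [exact: ltW|apply: mulr_ge0; lra].
by field; rewrite lt0r_neq0.
Qed.

(** Each term is bounded by an affine function of [u']: tangents at [m + 1] for the concave terms,
    and for [- ln (n - u')] the chord between [n - u] and [2 * (n - u)], valid since a round at most
    doubles the informed set. *)
Lemma upper_potential_drift n u m : 1 <= u -> u <= n - 1 -> 0 < m ->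
    ln u - 1 <= ln m -> ln m <= ln u - (n - u) / n ->
  exists b : R, forall u', 0 <= u' -> u' <= u -> u - u' <= n - u ->
    upper_potential n u' <= upper_potential n u - 1 + b * (u' - m).
Proof.
move=> u1 un m0 lm um.
have n0 : 0 < n by lra.
have k0 : 0 < n - u by lra.
have x0 : 0 < (n - u) / n by rewrite divr_gt0.
have x1 : (n - u) / n < 1 by rewrite ltr_pdivrMr; lra.
have u0 : 0 < u by lra.
have m1 : 0 < m + 1 by lra.
have gap := mul1D_le_of_ln _ _ _ (ltW x0) u0 m0 um.
have mu : m <= u by rewrite -ler_ln ?posrE//; lra.
(* [ln m >= ln u - 1 >= - 1 >= - ln 4], as [ln 2 >= 1/2]. *)
have m4 : 4^-1 <= m.
  rewrite -ler_ln ?posrE ?invr_gt0// lnV ?posrE//.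
  have -> : (4 : R) = 2 ^+ 2 by ring.
  by rewrite lnXn//; have := @ln2_ge_half R; have := ln_ge0 u1; lra.
have late := ln_succ_drift _ _ u0 m4 mu.
have early := doubling_drift n ((n - u) / n) m n0 x0 x1.
have uE : n * (1 - (n - u) / n) = u by field; exact: lt0r_neq0.
have kE : n * ((n - u) / n) = n - u by field; exact: lt0r_neq0.
rewrite uE kE in early; move/(_ gap): early => early.
(* The slopes of the chord, of the two tangents and of the linear term. *)
exists ((n - u)^-1 + (m + 1)^-1 + 5 / (m + 1) ^+ 2 + 4 / n) => u' u'0 u'u u'k.
have A : (ln n - ln (n - u')) / ln 2
    <= (ln n - ln (n - u)) / ln 2 + (m - u) / (n - u) + (n - u)^-1 * (u' - m).
  have h := ln_ge_secant (n - u) (n - u') k0 (ltac:(lra)) (ltac:(lra)).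
  rewrite ler_pdivrMr// 2!mulrDl divfK ?lt0r_neq0//.
  have e : (n - u' - (n - u)) / (n - u) * ln 2
     = - ((m - u) / (n - u) * ln 2) - (n - u)^-1 * (u' - m) * ln 2 by ring.
  rewrite e in h; lra.
have B : ln (u' + 1) <= ln (m + 1) + (m + 1)^-1 * (u' - m).
  have := ln_le_tangent (m + 1) (u' + 1) m1 (ltac:(lra)).
  by rewrite opprD addrACA subrr addr0 [_ / _]mulrC.
have C : 5 / (m + 1) - 5 / (m + 1) ^+ 2 * (u' - m) <= 5 / (u' + 1).
  have := inv_tangent (u' + 1) (m + 1) (ltac:(lra)) m1.
  by rewrite opprD addrACA subrr addr0; lra.
have e : 4 * (u' / n) = 4 * (u / n) + 4 * ((m - u) / n) + 4 / n * (u' - m) by ring.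
rewrite /upper_potential e.
move: (ln n) (ln (n - u')) (ln (n - u)) A => ? ? ? A.
have -> t : ((n - u)^-1 + (m + 1)^-1 + 5 / (m + 1) ^+ 2 + 4 / n) * t
  = (n - u)^-1 * t + (m + 1)^-1 * t + 5 / (m + 1) ^+ 2 * t + 4 / n * t by ring.
lra.
Qed.

(* While [n - u < n / 4] only an error of order [(n - u) / n] per round can be
   compensated, which the variance bound of the late case exceeds; the
   deterministic bounds [n - u' <= 2 * (n - u)] and [u - u' <= n - u] suffice. *)
Lemma lower_potential_drift_early n u m : n - n / 4 <= u -> u <= n - 1 -> 0 < m ->
    ln m <= ln u - (n - u) / n ->
  exists b : R, forall u', 0 <= u' -> u' <= u -> u - u' <= n - u ->
    lower_potential n u - 1 + b * (u' - m) <= lower_potential n u'.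
Proof.
move=> u1 un m0 um.
have n0 : 0 < n by lra.
have k0 : 0 < n - u by lra.
have u0 : 0 < u by lra.
have x0 : 0 < (n - u) / n by rewrite divr_gt0.
have gap := mul1D_le_of_ln _ _ _ (ltW x0) u0 m0 um.
(* The expected growth of the term [8 * ((n - u) / n)] pays for the loss of [ln (u + 1)] bounded in
   [B] below. *)
have D : 2 * ((n - u) / n) <= 8 * ((u - m) / n).
  have [x xE] : exists x, (n - u) / n = x by eexists.
  rewrite xE in x0 gap *.
  have x4 : x <= 4^-1 by rewrite -xE ler_pdivrMr; lra.
  have uE : u = n * (1 - x) by rewrite -xE; field; exact: lt0r_neq0.
  have mE : m <= u / (1 + x) by rewrite ler_pdivlMr; lra.
  rewrite mulrA ler_pdivlMr//.
  suff : u / (1 + x) <= u - n * x / 4 by lra.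
  rewrite ler_pdivrMr; last lra.
  rewrite uE -subr_ge0 (_ : _ - _ = n * x * (1 - x - (1 + x) / 4)); last by field.
  by apply: mulr_ge0; [apply: mulr_ge0; exact: ltW|lra].
(* Only the linear term contributes a slope; the others are bounded by their worst case. *)
exists (- (8 / n)) => u' u'0 u'u u'k.
have A : (ln n - ln (n - u)) / ln 2 - 1 <= (ln n - ln (n - u')) / ln 2.
  rewrite lerBlDr -[leRHS](mulfK (lt0r_neq0 ln2_gt0)) ler_pM2r ?invr_gt0//.
  rewrite mulrDl divfK ?lt0r_neq0// mul1r.
  have : ln (n - u') <= ln (2 * (n - u)) by rewrite ler_ln ?posrE; lra.
  by rewrite lnM ?posrE; lra.
have u'1 : 0 < u' + 1 by lra.
(* Uses [u' >= 2 * u - n >= n / 2]. *)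
have B : ln (u + 1) - 2 * ((n - u) / n) <= ln (u' + 1).
  have := ln_le_tangent (u' + 1) (u + 1) u'1 (ltac:(lra)).
  suff : (u + 1 - (u' + 1)) / (u' + 1) <= 2 * ((n - u) / n) by lra.
  rewrite ler_pdivrMr// mulrAC mulrA ler_pdivlMr//.
  have h1 : n * (u - u') <= n * (n - u) by rewrite ler_pM2l.
  have h2 : (n - u) * n <= (n - u) * (2 * (u' + 1)) by rewrite ler_pM2l; lra.
  lra.
have C : 40 / Num.sqrt (u + 1) <= 40 / Num.sqrt (u' + 1).
  apply: ler_wpM2l => //; rewrite lef_pV2 ?posrE ?sqrtr_gt0//; last by lra.
  by apply: ler_wsqrtr; lra.
have e : 8 * ((n - u') / n) = 8 * ((n - u) / n) + 8 * ((u - m) / n) - 8 / n * (u' - m).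
  by ring.
by rewrite /lower_potential e mulNr; lra.
Qed.

(** The hypotheses give [(m + 1) / (u + 1) <= 9/10 < (38/40)^2]. The gain of [2 / Num.sqrt (m + 1)]
    is what the variance of [u'] will cost in [ln (u' + 1)]. *)
Lemma inv_sqrt_gap u m : 1 <= u -> 0 < m -> m * (5 / 4) <= u ->
  40 / Num.sqrt (u + 1) <= 38 / Num.sqrt (m + 1).
Proof.
move=> u1 m0 mu.
have a0 : 0 < Num.sqrt (m + 1) by rewrite sqrtr_gt0; lra.
have b0 : 0 < Num.sqrt (u + 1) by rewrite sqrtr_gt0; lra.
rewrite ler_pdivrMr// mulrAC ler_pdivlMr//.
rewrite -(@ler_pXn2r _ 2) ?nnegrE//; try by apply: mulr_ge0 => //; exact: ltW.
by rewrite !exprMn !sqr_sqrtr; lra.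
Qed.

(** A lower bound on the concave [ln (u' + 1)] needs a quadratic error term. It is centred as
    [(u' - m) ^+ 2 - m], whose mean is at most 0 when the variance is at most [m]; the remaining
    [c * m] is absorbed by [inv_sqrt_gap]. *)
Lemma lower_potential_drift_late n u m : 1 <= u -> u <= n - n / 4 -> 0 < n -> 0 < m ->
    ln u - 1 <= ln m -> ln m <= ln u - (n - u) / n ->
  exists b c : R, 0 <= c /\ forall u', 0 <= u' -> u' <= u ->
    lower_potential n u - 1 + b * (u' - m) - c * ((u' - m) ^+ 2 - m)
      <= lower_potential n u'.
Proof.
move=> u1 un n0 m0 lm um.
have k0 : 0 < n - u by lra.
have u0 : 0 < u by lra.
have x4 : 4^-1 <= (n - u) / n by rewrite ler_pdivlMr; lra.
have x0 : 0 <= (n - u) / n by lra.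
have mu : m * (5 / 4) <= u.
  by apply: le_trans (mul1D_le_of_ln _ _ _ x0 u0 m0 um); rewrite ler_pM2l//; lra.
have E := inv_sqrt_gap _ _ u1 m0 mu.
have D : ln (u + 1) - 1 <= ln (m + 1).
  have um1 : 0 < u * (m + 1) by apply: mulr_gt0; lra.
  have mu1 : 0 < m * (u + 1) by apply: mulr_gt0; lra.
  have : ln (m * (u + 1)) <= ln (u * (m + 1)) by rewrite ler_ln ?posrE; lra.
  by rewrite !lnM ?posrE; lra.
have a0 : 0 < Num.sqrt (m + 1) by rewrite sqrtr_gt0; lra.
have aE : Num.sqrt (m + 1) ^+ 2 = m + 1 by rewrite sqr_sqrtr; lra.
have C u' (u'0 : 0 <= u') := inv_sqrt_tangent (u' + 1) (m + 1) (ltac:(lra)) (ltac:(lra)).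
move: (Num.sqrt (m + 1)) a0 aE C E => a a0 aE C E.
have F : 2 * m / a ^+ 3 <= 2 / a.
  rewrite ler_pdivrMr ?exprn_gt0// (_ : 2 / a * a ^+ 3 = 2 * a ^+ 2).
    by rewrite aE; lra.
  by field; exact: lt0r_neq0.
(* [b] adds the slopes of [ln] and of [40 / Num.sqrt] at [m + 1]; [c] is the coefficient of the
   square in [ln_ge_quadratic_at]. *)
exists ((m + 1)^-1 - 20 / a ^+ 3), (2 / a ^+ 3); split.
  by apply: divr_ge0 => //; rewrite exprn_ge0// ltW.
move=> u' u'0 u'u.
(* As [n - u >= n / 4] and [ln 2 >= 1/2], the slope is at most [8 / n]; the term [8 * ((n - u) / n)]
   cancels this loss exactly. *)
have A : (ln n - ln (n - u)) / ln 2 - 8 * ((u - u') / n) <= (ln n - ln (n - u')) / ln 2.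
  rewrite lerBlDr -[leRHS](mulfK (lt0r_neq0 ln2_gt0)) ler_pM2r ?invr_gt0//.
  rewrite mulrDl divfK ?lt0r_neq0//.
  have := ln_le_tangent (n - u) (n - u') k0 (ltac:(lra)).
  have -> : n - u' - (n - u) = u - u' by ring.
  have h2 : (u - u') / (n - u) <= (u - u') / (n / 4).
    by apply: ler_wpM2l; [lra|rewrite lef_pV2 ?posrE; lra].
  have h3 : (u - u') / (n / 4) <= 8 * ((u - u') / n) * ln 2.
    have -> : (u - u') / (n / 4) = 8 * ((u - u') / n) * 2^-1 by field; exact: lt0r_neq0.
    by apply: ler_wpM2l; [apply: mulr_ge0 => //; apply: divr_ge0; lra|exact: ln2_ge_half].
  lra.
have B : ln (m + 1) + (m + 1)^-1 * (u' - m) - 2 * (u' - m) ^+ 2 / a ^+ 3 <= ln (u' + 1).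
  have p : a ^- 2 <= (u' + 1) / a ^+ 2.
    by rewrite -[leLHS]mul1r ler_pM2r ?invr_gt0 ?exprn_gt0//; lra.
  have := ln_ge_quadratic_at a (u' + 1) a0 p.
  rewrite aE (_ : u' + 1 - (m + 1) = u' - m); last by ring.
  by rewrite [_ / (m + 1)]mulrC.
have G : 40 / a - 20 / a ^+ 3 * (u' - m) <= 40 / Num.sqrt (u' + 1).
  have := C _ u'0; rewrite -aE (_ : u' + 1 - a ^+ 2 = u' - m); last by rewrite aE; ring.
  have -> : (u' - m) / (2 * a ^+ 2 * a) = a ^- 3 * (u' - m) / 2.
    by field; exact: lt0r_neq0.
  by lra.
have e : 8 * ((n - u') / n) = 8 * ((n - u) / n) + 8 * ((u - u') / n) by ring.
rewrite /lower_potential e.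
have -> : 2 / a ^+ 3 * ((u' - m) ^+ 2 - m) = 2 * (u' - m) ^+ 2 / a ^+ 3 - 2 * m / a ^+ 3.
  by ring.
by rewrite mulrBl; lra.
Qed.

End Potentials.

(** * One round of the protocol *)

Section OneRound.
Context {R : realType} {n : nat}.
Implicit Types (S W : {set 'I_n}) (f : {ffun 'I_n -> 'I_n}).
Implicit Types F G : {ffun 'I_n -> 'I_n} -> R.

Definition push_step S f : {set 'I_n} := (S :|: [set f v | v in S])%SET.

(** Expectation over a uniformly random map, which also gives calls to the uninformed nodes; being a
    finite sum, it keeps the moment computations free of measure theory. *)
Definition round_mean F : R := n%:R^-1 ^+ n * \sum_f F f.

Lemma eq_round_mean F G : F =1 G -> round_mean F = round_mean G.
Proof. by move=> FG; congr (_ * _); apply: eq_bigr => f _; rewrite FG. Qed.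

Lemma le_round_mean F G : (forall f, F f <= G f) -> round_mean F <= round_mean G.
Proof.
move=> FG; apply: ler_wpM2l; first by rewrite exprn_ge0// invr_ge0.
by apply: ler_sum => f _.
Qed.

Lemma round_meanD F G : round_mean (fun f => F f + G f) = round_mean F + round_mean G.
Proof. by rewrite /round_mean big_split mulrDr. Qed.

Lemma round_meanZ c F : round_mean (fun f => c * F f) = c * round_mean F.
Proof. by rewrite /round_mean -mulr_sumr mulrCA. Qed.

Lemma round_mean_sum (I : finType) (A : pred I) (F : I -> {ffun 'I_n -> 'I_n} -> R) :
  round_mean (fun f => \sum_(i | A i) F i f) = \sum_(i | A i) round_mean (F i).
Proof. by rewrite /round_mean exchange_big mulr_sumr. Qed.

Lemma round_mean_cst c : (0 < n)%N -> round_mean (fun=> c) = c.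
Proof.
move=> n0; rewrite /round_mean sumr_const card_ffun card_ord -[c *+ _]mulr_natl natrX mulrA.
by rewrite exprVn mulVf ?mul1r// expf_neq0// pnatr_eq0 -lt0n.
Qed.

Definition avoids S W f := [forall v in S, f v \notin W].

(** Independence in the form of distributivity: the indicator is a product over callers, so the sum
    over all maps factors into one sum per caller. *)
Lemma round_mean_avoids S W : (0 < n)%N ->
  round_mean (fun f => (avoids S W f)%:R) = (1 - #|W|%:R / n%:R) ^+ #|S|.
Proof.
move=> n0; have nN0 : n%:R != 0 :> R by rewrite pnatr_eq0 -lt0n.
pose F (v w : 'I_n) : R := n%:R^-1 * ((v \in S) ==> (w \notin W))%:R.
transitivity (\sum_(f : {ffun 'I_n -> 'I_n}) \prod_v F v (f v)).
  rewrite /round_mean mulr_sumr; apply: eq_bigr => f _.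
  rewrite big_split /= prodr_const card_ord; congr (_ * _).
  rewrite /avoids; case: forallP => [h|h].
    by rewrite big1// => v _; rewrite h.
  have /existsP[v hv] : [exists v, ~~ ((v \in S) ==> (f v \notin W))].
    by rewrite -negb_forall; apply/negP => /forallP.
  by rewrite (bigD1 v)//= (negbTE hv) mul0r.
rewrite -bigA_distr_bigA /= (bigID (mem S)) /= [X in _ * X]big1 ?mulr1.
  rewrite (eq_bigr (fun=> 1 - #|W|%:R / n%:R)) ?prodr_const// => v vS.
  rewrite /F vS /= -mulr_sumr -natr_sum -big_mkcond /= sum1dep_card.
  rewrite (_ : #|_| = n - #|W|)%N; last first.
    apply/esym/eqP; rewrite -{1}(card_ord n) -(cardsC W) addKn.
    by apply/eqP/eq_card => w; rewrite !inE.
  rewrite natrB; last by rewrite -[leqRHS](card_ord n) max_card.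
  by rewrite mulrBr mulVf// [_ * #|_|%:R]mulrC.
move=> v /negbTE vS; rewrite /F vS /= -mulr_sumr sumr_const card_ord.
by rewrite mulVf.
Qed.

Definition uninformed S : R := #|~: S|%:R.

Lemma uninformed_step S f : uninformed (push_step S f) =
  \sum_(w | w \notin S) (avoids S [set w]%SET f)%:R.
Proof.
rewrite /uninformed -natr_sum -sum1dep_card; congr (_%:R).
rewrite big_mkcond [RHS]big_mkcond; apply: eq_bigr => w _.
rewrite !inE negb_or; case: (w \in S) => //=.
case: imsetP => [[v vS ->]|h] /=.
  by rewrite /avoids; case: forallP => // /(_ v); rewrite vS !inE eqxx.
rewrite /avoids; case: forallP => // h'; exfalso; apply: h' => v.
by apply/implyP => vS; rewrite !inE; apply/eqP => fv; apply: h; exists v.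
Qed.

Lemma uninformedE S : uninformed S = n%:R - #|S|%:R.
Proof.
by apply: (addrI #|S|%:R); rewrite -natrD cardsC card_ord addrC subrK.
Qed.

Definition mean_uninformed S : R := uninformed S * (1 - n%:R^-1) ^+ #|S|.

Lemma round_mean_uninformed S : (0 < n)%N ->
  round_mean (fun f => uninformed (push_step S f)) = mean_uninformed S.
Proof.
move=> n0; under eq_round_mean do rewrite uninformed_step.
rewrite round_mean_sum.
under eq_bigr do rewrite round_mean_avoids// cards1 mul1r.
rewrite sumr_const /mean_uninformed /uninformed [RHS]mulr_natl; congr (_ *+ _).
by apply: eq_card => w; rewrite !inE.
Qed.

(** Negative correlation: two distinct nodes are both missed with probability
    [(1 - 2/n)^k <= (1 - 1/n)^(2k)]. Hence only the diagonal pairs add to the squared mean. *)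
Lemma round_mean_uninformed_sqr S : (1 < n)%N ->
  round_mean (fun f => uninformed (push_step S f) ^+ 2)
    <= mean_uninformed S + mean_uninformed S ^+ 2.
Proof.
move=> n1; have n0 := ltnW n1.
set q := 1 - n%:R^-1 : R; set k := #|S|.
have q0 : 0 <= q by rewrite subr_ge0 invf_le1 ?ltr0n ?ler1n.
have pair w w' : round_mean (fun f =>
      (avoids S [set w]%SET f)%:R * (avoids S [set w']%SET f)%:R)
    <= (w == w')%:R * q ^+ k + q ^+ k * q ^+ k.
  rewrite (eq_round_mean _ (fun f => (avoids S [set w; w']%SET f)%:R)); last first.
    move=> f; rewrite -natrM mulnb; congr (nat_of_bool _)%:R.
    rewrite /avoids; apply/andP/forallP => [[/forallP h /forallP h'] v|h].
      apply/implyP => vS; have := h v; have := h' v.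
      by rewrite vS !inE /= negb_or => -> ->.
    split; apply/forallP => v; have := h v; case: (v \in S) => //=.
      by rewrite !inE negb_or => /andP[].
    by rewrite !inE negb_or => /andP[].
  rewrite round_mean_avoids// cards2 -/k.
  case: eqVneq => [_|_] /=; first by rewrite mul1r mul1r lerDl mulr_ge0 ?exprn_ge0.
  rewrite mul0r add0r -exprMn; case: k => [|k']; first by rewrite !expr0.
  rewrite lerXn2r ?nnegrE ?mulr_ge0//.
    by rewrite subr_ge0 ler_pdivrMr ?ltr0n// mul1r ler_nat.
  have : 0 <= n%:R^-1 ^+ 2 :> R by exact: sqr_ge0.
  by rewrite /q; lra.
under eq_round_mean do rewrite uninformed_step expr2 big_distrlr /=.
rewrite round_mean_sum; under eq_bigr do rewrite round_mean_sum.
apply: (@le_trans _ _ (\sum_(w | w \notin S) \sum_(w' | w' \notin S)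
    ((w == w')%:R * q ^+ k + q ^+ k * q ^+ k))).
  by apply: ler_sum => w _; apply: ler_sum => w' _.
have cardE : \sum_(w | w \notin S) (1:R) = uninformed S.
  by rewrite sumr_const /uninformed; congr (_%:R); apply: eq_card => w; rewrite !inE.
rewrite le_eqVlt; apply/orP; left; apply/eqP.
transitivity (\sum_(w | w \notin S) (1 * q ^+ k + 1 * (uninformed S * q ^+ k * q ^+ k))).
  apply: eq_bigr => w wS; rewrite big_split /=; congr (_ + _).
    rewrite -mulr_suml (bigD1 w)//= eqxx big1 ?addr0// => w' /andP[_ /negbTE].
    by rewrite eq_sym => ->.
  by rewrite -cardE !mulr_suml mul1r; apply: eq_bigr => w' _; rewrite mul1r.
by rewrite big_split /= -!mulr_suml cardE /mean_uninformed -/q -/k; ring.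
Qed.

Lemma round_variance_uninformed S : (1 < n)%N ->
  round_mean (fun f => (uninformed (push_step S f) - mean_uninformed S) ^+ 2)
    <= mean_uninformed S.
Proof.
move=> n1; set m := mean_uninformed S.
rewrite (eq_round_mean _ (fun f => uninformed (push_step S f) ^+ 2
   + (- (2 * m) * uninformed (push_step S f) + m ^+ 2))); last by move=> f; ring.
rewrite (round_meanD (fun f => uninformed (push_step S f) ^+ 2)).
rewrite (round_meanD (fun f => - (2 * m) * uninformed (push_step S f))).
rewrite round_meanZ round_mean_uninformed ?(ltnW n1)// round_mean_cst ?(ltnW n1)//.
have := round_mean_uninformed_sqr _ n1 : _ <= m + m ^+ 2; rewrite -/m; lra.
Qed.

End OneRound.

(** * Expected drift of the potentials in one round *)

Section RoundDrift.
Context {R : realType} {n : nat}.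
Variable S : {set 'I_n}.
Hypothesis S_gt0 : (0 < #|S|)%N.
Hypothesis S_lt : (#|S| < n)%N.

Local Notation u := (@uninformed R n S).
Local Notation m := (@mean_uninformed R n S).
Local Notation u' f := (@uninformed R n (push_step S f)).

Let n_gt1 : (1 < n)%N. Proof. exact: leq_ltn_trans S_gt0 S_lt. Qed.
Let nR : 2 <= n%:R :> R. Proof. by rewrite ler_nat. Qed.

Let u_ge1 : 1 <= u.
Proof. by rewrite uninformedE lerBrDl natr1 ler_nat. Qed.

Let u_le : u <= n%:R - 1.
Proof. by rewrite uninformedE lerB// ler1n. Qed.

Let uC : n%:R - u = #|S|%:R. Proof. by rewrite uninformedE subKr. Qed.

Let u'_ge0 f : 0 <= u' f. Proof. exact: ler0n. Qed.

Let u'_le f : u' f <= u.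
Proof. by rewrite !uninformedE lerB// ler_nat subset_leq_card// finset.subsetUl. Qed.

Let u'_ge f : u - u' f <= n%:R - u.
Proof.
have : #|push_step S f|%:R <= #|S|%:R + #|S|%:R :> R.
  rewrite -natrD ler_nat (leq_trans (leq_card_setU _ _))// leq_add2l.
  exact: leq_imset_card.
by rewrite uC !uninformedE; lra.
Qed.

Let q_gt0 : 0 < 1 - n%:R^-1 :> R.
Proof.
by rewrite subr_gt0 invf_lt1 ?ltr0n ?ltr1n// (ltnW n_gt1).
Qed.

Let m_gt0 : 0 < m.
Proof. by apply: mulr_gt0; [exact: lt_le_trans u_ge1|exact: exprn_gt0]. Qed.

Let ln_m : ln m = ln u + #|S|%:R * ln (1 - n%:R^-1).
Proof.
by rewrite lnM ?posrE ?exprn_gt0 ?(lt_le_trans _ u_ge1)// lnXn// mulr_natl.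
Qed.

Let ln_m_le : ln m <= ln u - (n%:R - u) / n%:R.
Proof.
rewrite ln_m uC lerD2l -mulrN; apply: ler_wpM2l => //.
by have := ln_le_sub1 _ q_gt0; lra.
Qed.

(** [ln (1 - 1/n) >= - 1/(n - 1)], and at most [n - 1] nodes call since one is still uninformed. *)
Let ln_m_ge : ln u - 1 <= ln m.
Proof.
rewrite ln_m lerD2l; have h := ln_ge_sub_inv _ q_gt0.
have n1 : 0 < n%:R - 1 :> R by have := nR; lra.
have qE : 1 - (1 - n%:R^-1)^-1 = - (n%:R - 1)^-1 :> R by field; have := nR; lra.
rewrite qE in h.
apply: le_trans (ler_wpM2l _ h); rewrite // mulrN lerN2 ler_pdivrMr// mul1r.
by have := u_ge1; rewrite -uC; lra.
Qed.

(** Averaging removes the term [b * (u' - m)], as [m] is the mean of [u']. *)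
Lemma upper_potential_round :
  round_mean (fun f => upper_potential n%:R (u' f)) <= upper_potential n%:R u - 1.
Proof.
have [b hb] := upper_potential_drift _ _ _ u_ge1 u_le m_gt0 ln_m_ge ln_m_le.
apply: (@le_trans _ _ (round_mean (fun f =>
    (upper_potential n%:R u - 1 - b * m) + b * u' f))).
  by apply: le_round_mean => f; have := hb _ (u'_ge0 f) (u'_le f) (u'_ge f); lra.
rewrite (round_meanD (fun=> _)) round_meanZ round_mean_cst ?round_mean_uninformed ?(ltnW n_gt1)//.
by lra.
Qed.

Lemma lower_potential_round :
  lower_potential n%:R u - 1 <= round_mean (fun f => lower_potential n%:R (u' f)).
Proof.
have [b [c [c0 hb]]] : exists b c : R, 0 <= c /\ forall f,
    lower_potential n%:R u - 1 + b * (u' f - m) - c * ((u' f - m) ^+ 2 - m)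
    <= lower_potential n%:R (u' f).
  (* The early case, with at most a quarter of the nodes informed, has no variance term, so [c = 0]
     there. *)
  have [u_early|u_late] := leP (n%:R - n%:R / 4) u.
    have [b hb] := lower_potential_drift_early _ _ _ u_early u_le m_gt0 ln_m_le.
    exists b, 0; split => // f; rewrite mul0r subr0.
    exact: (hb _ (u'_ge0 f) (u'_le f) (u'_ge f)).
  have n0 : 0 < n%:R :> R by have := nR; lra.
  have [b [c [c0 hb]]] :=
    lower_potential_drift_late _ _ _ u_ge1 (ltW u_late) n0 m_gt0 ln_m_ge ln_m_le.
  by exists b, c; split => // f; exact: (hb _ (u'_ge0 f) (u'_le f)).
apply: (@le_trans _ _ (round_mean (fun f =>
    (lower_potential n%:R u - 1 - b * m + c * m) + (b * u' f + - c * (u' f - m) ^+ 2)))).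
  rewrite (round_meanD (fun=> _)) (round_meanD (fun f => b * u' f)).
  rewrite !round_meanZ round_mean_cst ?round_mean_uninformed ?(ltnW n_gt1)//.
  by have := ler_wpM2l c0 (@round_variance_uninformed R n S n_gt1); lra.
by apply: le_round_mean => f; have := hb f; lra.
Qed.

End RoundDrift.

(** * The distribution of the informed set *)

Lemma measure_bigcup_finType {R : realType} {d} {T : measurableType d}
    (mu : {measure set T -> \bar R}) (I : finType) (D : pred I) (F : I -> set T) :
  (forall i, D i -> measurable (F i)) -> trivIset [set` D] F ->
  mu (\bigcup_(i in [set` D]) F i) = (\sum_(i | D i) mu (F i))%E.
Proof.
move=> mF tF; rewrite measure_fin_bigcup//.
rewrite -(@bigfs _ _ _ _ (index_enum I) D)//; first exact: index_enum_uniq.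
by move=> i _; rewrite mem_index_enum.
Qed.

Section Markov.
Context {R : realType} {d : measure_display} {Omega : measurableType d}.
Variables (P : probability Omega R) (n : nat) (X : nat * 'I_n -> Omega -> 'I_n).
Variable v0 : 'I_n.
Hypothesis callsX : push_calls P X.

Local Notation I t w := (informed (fun i => X i w) v0 t).

Let row t : seq (nat * 'I_n) := [seq (t, v) | v <- enum 'I_n].

Let mX i A : measurable (X i @^-1` A). Proof. by case: callsX. Qed.

Let independent_seq (s : seq (nat * 'I_n)) (A : nat * 'I_n -> set 'I_n) : uniq s ->
  P (\bigcap_(i in [set` s]) X i @^-1` A i) = (\prod_(i <- s) P (X i @^-1` A i))%E.
Proof.
move=> us; have [_ _ /(_ [fset i in s]%fset A)] := callsX.
rewrite (perm_big s); last first.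
  by apply: uniq_perm => // [|i]; [exact: fset_uniq|rewrite inE].
move=> <-; congr (P _); apply: eq_bigcapl.
by split => i /=; rewrite inE.
Qed.

Let round t (f : {ffun 'I_n -> 'I_n}) : set Omega :=
  \bigcap_(i in [set` row t]) X i @^-1` [set f i.2].

Let roundP t f w : round t f w <-> f = [ffun v => X (t, v) w].
Proof.
split=> [h|-> i /mapP[v _ ->]/=]; last by rewrite ffunE.
apply/ffunP => v; rewrite ffunE; apply/esym/(h (t, v)) => /=.
by apply/mapP; exists v; rewrite ?mem_enum.
Qed.

Let informedS t w : I t.+1 w = push_step (I t w) [ffun v => X (t, v) w].
Proof.
rewrite /= /push_step; congr (_ :|: _)%SET.
by apply: eq_imset => v; rewrite ffunE.
Qed.

(** Splits by the informed set at time [t] and the calls of that round. The pieces are disjoint by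
    [history_inj], so probabilities become finite sums. *)
Let informedS_event t S : [set w | I t.+1 w = S] =
  \bigcup_(p in [set` (fun p : {set 'I_n} * {ffun 'I_n -> 'I_n} => push_step p.1 p.2 == S)])
    ([set w | I t w = p.1] `&` round t p.2).
Proof.
apply/seteqP; split => w.
  move=> wS; exists (I t w, [ffun v => X (t, v) w]).
    by apply/eqP; rewrite -informedS.
  by split => //; apply/roundP.
move=> [[S' f] /eqP/= pS [/= wS' /roundP wf]].
by suff : I t.+1 w = S by []; rewrite informedS -wf wS'.
Qed.

Let history_inj t (p p' : {set 'I_n} * {ffun 'I_n -> 'I_n}) w :
  I t w = p.1 -> round t p.2 w -> I t w = p'.1 -> round t p'.2 w -> p = p'.
Proof. by case: p p' => [S f] [S' f'] /= <- /roundP -> <- /roundP ->. Qed.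

Let mround t f : measurable (round t f).
Proof. by apply: fin_bigcap_measurable => // i _; exact: mX. Qed.

Lemma measurable_informed t S : measurable [set w | I t w = S].
Proof.
elim: t S => [S|t IH S].
  have [e|e] := eqVneq [set v0]%SET S.
    by rewrite (_ : [set _ | _] = setT)//; apply/seteqP; split.
  by rewrite (_ : [set _ | _] = set0)//; apply/seteqP; split => // w /= /eqP; rewrite (negbTE e).
rewrite informedS_event; apply: fin_bigcup_measurable; first exact: finite_finset.
by move=> p _; exact: measurableI.
Qed.

Let q : R := n%:R^-1.

(** Prescribing round [t] and keeping the later events [A] gives a single family of future events,
    as the induction hypothesis of [past_future] requires. *)
Let round_cyl (t : nat) (f : {ffun 'I_n -> 'I_n}) (A : nat * 'I_n -> set 'I_n) :=
  fun i => if i.1 == t then [set f i.2] else A i.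

Let uniq_row t : uniq (row t).
Proof. by rewrite map_inj_uniq ?enum_uniq// => v v' []. Qed.

Let prod_row t f (A : nat * 'I_n -> set 'I_n) : (forall v, A (t, v) = [set f v]) ->
  (\prod_(i <- row t) P (X i @^-1` A i))%E = (q ^+ n)%:E.
Proof.
move=> Af; rewrite big_map (eq_bigr (fun=> q%:E)).
  by rewrite prodEFin big_enum prodr_const card_ord.
by move=> v _; rewrite Af; case: callsX.
Qed.

(* Allowing arbitrary future events makes the induction on [t] go through: the
   calls of one round are moved from the future to the past. *)
Let past_future t S (s : seq (nat * 'I_n)) A :
    uniq s -> (forall i, i \in s -> (t <= i.1)%N) ->
  P ([set w | I t w = S] `&` \bigcap_(i in [set` s]) X i @^-1` A i) =
  (P [set w | I t w = S] * \prod_(i <- s) P (X i @^-1` A i))%E.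
Proof.
have mcyl (s' : seq (nat * 'I_n)) A' :
    measurable (\bigcap_(i in [set` s']) X i @^-1` (A' i : set 'I_n)).
  by apply: fin_bigcap_measurable => // i _; exact: mX.
elim: t S s A => [S s A us _|t IH S s A us hs].
  have [e|e] := eqVneq [set v0]%SET S.
    rewrite (_ : [set _ | _] = setT); last by apply/seteqP; split.
    by rewrite setTI probability_setT mul1e independent_seq.
  rewrite (_ : [set _ | _] = set0).
    by rewrite set0I measure0 mul0e.
  by apply/seteqP; split => // w /= /eqP; rewrite (negbTE e).
have cylE f : round t f `&` \bigcap_(i in [set` s]) X i @^-1` A i =
    \bigcap_(i in [set` row t ++ s]) X i @^-1` round_cyl t f A i.
  rewrite (_ : [set` row t ++ s] = [set` row t] `|` [set` s]); last first.
    apply/seteqP; split => i /=; rewrite mem_cat; first by move/orP.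
    by move=> [->|->]; rewrite ?orbT.
  rewrite bigcap_setU; congr (_ `&` _); apply: eq_bigcapr => i /=.
    by move=> /mapP[v _ ->]; rewrite /round_cyl eqxx.
  by move=> /hs ti; rewrite /round_cyl gtn_eqF.
have stepP S' f :
    P ([set w | I t w = S'] `&` round t f `&` \bigcap_(i in [set` s]) X i @^-1` A i) =
    (P [set w | I t w = S'] * (q ^+ n)%:E * \prod_(i <- s) P (X i @^-1` A i))%E.
  rewrite -setIA cylE IH.
  - rewrite big_cat /= muleA; congr (_ * _ * _)%E.
      by rewrite (prod_row _ f)// => v; rewrite /round_cyl eqxx.
    by apply: eq_big_seq => i /hs ti; rewrite /round_cyl gtn_eqF.
  - rewrite cat_uniq uniq_row us andbT; apply/hasPn => i /hs ti.
    by apply/negP => /mapP[v _ iE]; rewrite iE ltnn in ti.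
  - move=> i; rewrite mem_cat => /orP[/mapP[v _ ->]//|/hs]; exact: ltnW.
have stepP' S' f :
    P ([set w | I t w = S'] `&` round t f) = (P [set w | I t w = S'] * (q ^+ n)%:E)%E.
  rewrite IH ?(prod_row _ f)//; last by move=> i /mapP[v _ ->].
(* Both sides are sums over the same histories, and the product over [s] factors out of every
   summand. *)
rewrite informedS_event setI_bigcupl measure_bigcup_finType; first last.
- by move=> p p' _ _ [w [[[+ +] _] [[+ +] _]]]; exact: history_inj.
- move=> p _; apply: measurableI => //; apply: measurableI => //.
  exact: measurable_informed.
rewrite measure_bigcup_finType; first last.
- by move=> p p' _ _ [w [[+ +] [+ +]]]; exact: history_inj.
- by move=> p _; apply: measurableI => //; exact: measurable_informed.
rewrite ge0_sume_distrl; last by [].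
apply: eq_bigr => p _.
apply: (etrans (stepP p.1 p.2)); congr (_ * _)%E; exact: esym (stepP' p.1 p.2).
Qed.

Definition informed_law t S : R := fine (P [set w | I t w = S]).

Lemma lawE t S : P [set w | I t w = S] = (informed_law t S)%:E.
Proof. by rewrite fineK// fin_num_measure//; exact: measurable_informed. Qed.

Lemma law_ge0 t S : 0 <= informed_law t S.
Proof. by rewrite fine_ge0. Qed.

Lemma law0 S : informed_law 0 S = (S == [set v0]%SET)%:R.
Proof.
rewrite /informed_law; have [->|e] := eqVneq.
  by rewrite (_ : [set _ | _] = setT) ?probability_setT//; apply/seteqP; split.
rewrite (_ : [set _ | _] = set0) ?measure0//.
by apply/seteqP; split => // w /= /eqP; rewrite eq_sym (negbTE e).
Qed.

Lemma lawS t S : informed_law t.+1 S =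
  \sum_(p : {set 'I_n} * {ffun 'I_n -> 'I_n} | push_step p.1 p.2 == S)
    informed_law t p.1 * n%:R^-1 ^+ n.
Proof.
apply: EFin_inj; rewrite -lawE informedS_event measure_bigcup_finType; first last.
- by move=> p p' _ _ [w [[+ +] [+ +]]]; exact: history_inj.
- by move=> p _; apply: measurableI => //; exact: measurable_informed.
rewrite -sumEFin; apply: eq_bigr => p _.
rewrite EFinM -lawE -(@prod_row t p.2 (fun i => [set p.2 i.2]))//.
apply: past_future => [|i /mapP[v _ ->]//]; exact: uniq_row.
Qed.

(** The Markov property, tested against [g]. *)
Lemma law_round_mean t (g : {set 'I_n} -> R) :
  \sum_S informed_law t.+1 S * g S =
  \sum_S informed_law t S * round_mean (fun f => g (push_step S f)).
Proof.
under eq_bigr do rewrite lawS mulr_suml.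
rewrite (exchange_big_dep predT)//=.
rewrite (eq_bigr (fun p => informed_law t p.1 * n%:R^-1 ^+ n * g (push_step p.1 p.2))); last first.
  by move=> p _; rewrite (big_pred1 (push_step p.1 p.2))// => S; rewrite eq_sym.
rewrite -(pair_bigA _ (fun S f => informed_law t S * n%:R^-1 ^+ n * g (push_step S f)))/=.
apply: eq_bigr => S _; rewrite /round_mean mulrA mulr_sumr.
by apply: eq_bigr.
Qed.

End Markov.

(** * The spreading time *)

Lemma informed_le {n} (call : nat * 'I_n -> 'I_n) v0 s t : (s <= t)%N ->
  informed call v0 s \subset informed call v0 t.
Proof.
elim: t => [|t IH]; first by rewrite leqn0 => /eqP->.
rewrite leq_eqVlt => /predU1P[->//|]; rewrite ltnS => /IH h.
exact: (fintype.subset_trans h (finset.subsetUl _ _)).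
Qed.

Lemma start_informed {n} (call : nat * 'I_n -> 'I_n) v0 t : v0 \in informed call v0 t.
Proof. by apply: (fintype.subsetP (informed_le call v0 0 t _)); rewrite ?inE. Qed.

(** Holds for every sequence of calls: informed sets only grow, so the indicator is 1 exactly before
    the spreading time. If some node is never informed, both sides are [+oo]. *)
Lemma spreading_time_series {R : realType} {n} (call : nat * 'I_n -> 'I_n) v0 :
  spreading_time R call v0 =
  (\sum_(0 <= t <oo) ((informed call v0 t != [set: 'I_n]%SET)%:R : R)%:E)%E.
Proof.
set a := fun t => informed call v0 t != [set: 'I_n]%SET.
have a0 t : (0 <= (a t)%:R%:E :> \bar R)%E by rewrite lee_fin.
have fullP t : (forall v, v \in informed call v0 t) <-> ~~ a t.
  rewrite /a negbK; split => [h|/eqP-> v]; last by rewrite inE.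
  by apply/eqP/setP => v; rewrite h inE.
have aS s t : (s <= t)%N -> ~~ a s -> ~~ a t.
  move=> st /fullP h; apply/fullP => v.
  exact: (fintype.subsetP (informed_le call v0 s t st)).
apply/eqP; rewrite eq_le; apply/andP; split; last first.
  apply: le_ereal_inf_tmp => _ [t /fullP at0 <-].
  apply: lime_le; first by apply: is_cvg_nneseries.
  apply: nearW => k; rewrite sumEFin lee_fin -natr_sum ler_nat.
  rewrite (leq_trans (_ : _ <= \sum_(0 <= i < k) (i < t))%N)//.
    apply: leq_sum => i _; rewrite -/(a i); case: (ltnP i t) => [_|ti].
      by rewrite leq_b1.
    by rewrite (negbTE (aS _ _ ti at0)).
  (* The bound by [t] alone is not inductive. *)
  suff : (\sum_(0 <= i < k) (i < t) <= minn k t)%N by rewrite leq_min => /andP[].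
  elim: k => [|k IH]; first by rewrite big_geq.
  rewrite big_nat_recr//=; case: (ltnP k t) => kt /=.
    by rewrite (minn_idPl kt) addn1 ltnS (leq_trans IH)// geq_minl.
  by rewrite addn0 (minn_idPr (leqW kt)) (leq_trans IH)// geq_minr.
have partial N : (forall i, (i < N)%N -> a i) ->
    (N%:R%:E <= \sum_(0 <= t <oo) ((a t)%:R : R)%:E)%E.
  move=> aN; apply: (@le_trans _ _ (\sum_(0 <= t < N) ((a t)%:R : R)%:E)%E).
    2: exact: nneseries_lim_ge.
  rewrite sumEFin lee_fin -natr_sum ler_nat big_nat (eq_bigr (fun=> 1%N)).
    by rewrite -big_nat sum_nat_const_nat subn0 muln1.
  by move=> i /= iN; rewrite aN.
have [[t0 at0]|h] := pselect (exists t, ~~ a t).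
  have ex : exists t, (fun t => ~~ a t) t by exists t0.
  have [N aN Nmin] := ex_minnP ex.
  apply: (@le_trans _ _ N%:R%:E).
    by apply: ereal_inf_lbound; exists N => //; apply/fullP.
  apply: partial => i iN; case e : (a i) => //.
  by have := Nmin i; rewrite e leqNgt iN => /(_ isT).
rewrite (_ : (\sum_(_ <= _ <oo) _)%E = +oo%E) ?leey//.
apply/eqyP => r r0; apply: (@le_trans _ _ (Num.truncn r).+1%:R%:E).
  by rewrite lee_fin ltW// truncnS_gt.
apply: partial => i _; case e : (a i) => //; exfalso; apply: h; exists i.
by rewrite e.
Qed.


(** * The expectation as a series, and telescoping of the potentials *)

Section SpreadingTime.
Context {R : realType} {d : measure_display} {Omega : measurableType d}.
Variables (P : probability Omega R) (n : nat) (X : nat * 'I_n -> Omega -> 'I_n).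
Variable v0 : 'I_n.
Hypothesis callsX : push_calls P X.

Local Notation I t w := (informed (fun i => X i w) v0 t).
Local Notation law := (informed_law P n X v0).
Local Notation u S := (@uninformed R n S).

Let n_gt0 : (0 < n)%N. Proof. exact: leq_ltn_trans (ltn_ord v0). Qed.

Definition survival t : R := \sum_(S | S != [set: 'I_n]%SET) law t S.

Lemma survival_ge0 t : 0 <= survival t.
Proof. by apply: sumr_ge0 => S _; exact: law_ge0. Qed.

(** Exchange of integral and series for nonnegative terms. *)
Lemma expected_spreading_timeE :
  expected_spreading_time P X v0 = (\sum_(0 <= t <oo) (survival t)%:E)%E.
Proof.
pose B t := \bigcup_(S in [set` (fun S : {set 'I_n} => S != [set: 'I_n]%SET)]) [set w | I t w = S].
have mB t : measurable (B t).
  apply: fin_bigcup_measurable; first exact: finite_finset.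
  by move=> S _; exact: (measurable_informed P).
have PB t : P (B t) = (survival t)%:E.
  rewrite measure_bigcup_finType; first last.
  - move=> S S' _ _ [w [hS hS']]; exact: etrans (esym hS) hS'.
  - by move=> S _; exact: (measurable_informed P).
  by rewrite -sumEFin; apply: eq_bigr => S _; exact: lawE.
have BE t w : ((I t w != [set: 'I_n]%SET)%:R : R) = \1_(B t) w.
  rewrite indicE; congr (nat_of_bool _)%:R.
  apply/idP/idP => [h|]; first by rewrite inE; exists (I t w).
  by rewrite inE => -[S hS wS]; have -> : I t w = S by [].
rewrite /expected_spreading_time.
under eq_integral do rewrite spreading_time_series.
rewrite integral_nneseries//; last first.
  move=> t; apply/measurable_EFinP; under eq_fun do rewrite BE.
  exact: measurable_indic.
apply: eq_eseriesr => t _; under eq_integral do rewrite BE.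
rewrite integral_indic; [rewrite setIT; exact: PB|exact: measurableT|exact: mB].
Qed.

(** [v0] is always informed, so the empty set, excluded by the drift lemmas, has probability 0. *)
Let law_neq0 t S : law t S != 0 -> (0 < #|S|)%N.
Proof.
apply: contraNT; rewrite -leqNgt leqn0 cards_eq0 => /eqP->.
rewrite /informed_law (_ : [set _ | _] = set0) ?measure0//.
apply/seteqP; split => // w /= h.
by have := start_informed (fun i => X i w) v0 t; rewrite h inE.
Qed.

Let sum_law0 (g : {set 'I_n} -> R) : \sum_S law 0 S * g S = g [set v0]%SET.
Proof.
rewrite (bigD1 [set v0]%SET)//= law0 eqxx mul1r big1 ?addr0// => S /negbTE S0.
by rewrite law0 S0 mul0r.
Qed.

Let round_mean_full (g : {set 'I_n} -> R) :
  round_mean (fun f => g (push_step [set: 'I_n]%SET f)) = g [set: 'I_n]%SET.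
Proof.
rewrite -[RHS](round_mean_cst (n := n))//; apply: eq_round_mean => f.
by rewrite /push_step finset.setTU.
Qed.

Let card_lt (S : {set 'I_n}) : S != [set: 'I_n]%SET -> (#|S| < n)%N.
Proof. by rewrite -finset.properT => /proper_card; rewrite cardsT card_ord. Qed.

Let drift_sum (g : {set 'I_n} -> R) t :
  \sum_S law t S * (g S - (S != [set: 'I_n]%SET)%:R) = \sum_S law t S * g S - survival t.
Proof.
under eq_bigr do rewrite mulrBr; rewrite big_split sumrN; congr (_ - _).
rewrite /survival [RHS]big_mkcond; apply: eq_bigr => S _.
by case: (_ != _); rewrite ?mulr1 ?mulr0.
Qed.

(** The expected potential loses at least [survival t] in round [t], since the full set is
    absorbing, and it stays nonnegative. *)
Lemma sum_survival_le M :
  \sum_(0 <= t < M) survival t <= upper_potential n%:R (n%:R - 1).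
Proof.
pose E t := \sum_S law t S * upper_potential n%:R (u S).
have ES t : E t.+1 <= E t - survival t.
  rewrite /E law_round_mean// -drift_sum; apply: ler_sum => S _.
  have [->|/law_neq0 S0] := eqVneq (law t S) 0; first by rewrite !mul0r.
  apply: ler_wpM2l; first exact: law_ge0.
  have [->|/card_lt Sn] := eqVneq.
    by rewrite (round_mean_full (fun S => upper_potential n%:R (u S))) subr0.
  exact: upper_potential_round.
have E0 : E 0 = upper_potential n%:R (n%:R - 1).
  by rewrite /E sum_law0 uninformedE cards1.
have EM : 0 <= E M.
  apply: sumr_ge0 => S _.
  have [->|/law_neq0 S0] := eqVneq (law M S) 0; first by rewrite mul0r.
  rewrite mulr_ge0 ?law_ge0// /upper_potential.
  have u0 : 0 <= u S by exact: ler0n.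
  have nu : n%:R - u S = #|S|%:R by rewrite uninformedE subKr.
  have nR : 1 <= n%:R :> R by rewrite ler1n.
  have a1 : 0 <= (ln n%:R - ln (n%:R - u S)) / ln 2 :> R.
    have := @ln2_ge_half R => l2; apply: divr_ge0; last lra.
    rewrite subr_ge0 nu ler_ln ?posrE ?ltr0n// ler_nat.
    by rewrite -[leqRHS](card_ord n) max_card.
  have a2 : 0 <= ln (u S + 1) by apply: ln_ge0; lra.
  have a3 : 5 / (u S + 1) <= 5 by rewrite ler_pdivrMr; lra.
  have a4 : 0 <= u S / n%:R by rewrite divr_ge0.
  lra.
suff : \sum_(0 <= t < M) survival t <= E 0 - E M by lra.
elim: M {EM} => [|M IH]; first by rewrite big_geq// subrr.
by rewrite big_nat_recr//=; have := ES M; lra.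
Qed.

(** Telescoping leaves the final expected potential, which must be made at most 1. The potential
    vanishes on the full set, so [B * survival M] bounds it, and [survival] becomes small because
    its partial sums are bounded by [sum_survival_le]. *)
Lemma sum_survival_ge : exists M,
  lower_potential n%:R (n%:R - 1) - 1 <= \sum_(0 <= t < M) survival t.
Proof.
pose E t := \sum_S law t S * lower_potential n%:R (u S).
have ES t : E t - survival t <= E t.+1.
  rewrite /E law_round_mean// -drift_sum; apply: ler_sum => S _.
  have [->|/law_neq0 S0] := eqVneq (law t S) 0; first by rewrite !mul0r.
  apply: ler_wpM2l; first exact: law_ge0.
  have [->|/card_lt Sn] := eqVneq.
    by rewrite (round_mean_full (fun S => lower_potential n%:R (u S))) subr0.
  exact: lower_potential_round.
have E0 : E 0 = lower_potential n%:R (n%:R - 1).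
  by rewrite /E sum_law0 uninformedE cards1.
(* A crude bound depending on [n]; it only affects the choice of [M]. *)
pose B : R := 1 + \sum_(S : {set 'I_n}) `|lower_potential n%:R (u S)|.
have B0 : 0 < B by rewrite ltr_pwDl// sumr_ge0.
have EB t : E t <= B * survival t.
  rewrite /E (bigD1 [set: 'I_n]%SET)//= {1}uninformedE cardsT card_ord subrr.
  rewrite (_ : lower_potential _ _ = 0) ?mulr0 ?add0r; last first.
    rewrite /lower_potential subr0 subrr mul0r !add0r sqrtr1 ln1 divr1 divff; last first.
      by rewrite pnatr_eq0 -lt0n.
    by ring.
  rewrite mulr_sumr; apply: ler_sum => S _; rewrite mulrC.
  apply: ler_wpM2r; first exact: law_ge0.
  apply: (le_trans (ler_norm _)); rewrite /B (bigD1 S)//= addrCA lerDl.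
  by rewrite addr_ge0// sumr_ge0.
have [M hM] : exists M, survival M <= B^-1.
  apply: contrapT => h.
  have big t : B^-1 < survival t by rewrite ltNge; apply/negP => ?; apply: h; exists t.
  set U : R := upper_potential n%:R (n%:R - 1).
  pose M := (Num.truncn (U * B)).+1.
  have : M%:R * B^-1 <= U.
    apply: le_trans (sum_survival_le M); rewrite -[M in M%:R]subn0 mulr_natl.
    rewrite -sumr_const_nat; apply: ler_sum => t _; exact: ltW.
  rewrite ler_pdivrMr// leNgt => /negP; apply; exact: truncnS_gt.
exists M.
have hEM : E M <= 1.
  by rewrite (le_trans (EB M))// mulrC -ler_pdivlMr// mul1r.
suff : E 0 - E M <= \sum_(0 <= t < M) survival t by lra.
elim: M {hM hEM} => [|M IH]; first by rewrite big_geq// subrr.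
by rewrite big_nat_recr//=; have := ES M; lra.
Qed.

End SpreadingTime.

Theorem theorem51 (R : realType) :
  exists (C : R) (N : nat), forall n : nat, (N <= n)%N ->
    forall (d : measure_display) (Omega : measurableType d)
      (P : probability Omega R) (X : nat * 'I_n -> Omega -> 'I_n) (v0 : 'I_n),
      push_calls P X ->
      (`| expected_spreading_time P X v0
          - (log2 (n%:R : R) + ln (n%:R : R))%:E | <= C%:E)%E.
Proof.
(* At [u = n - 1] the upper potential exceeds [log2 n + ln n] by at most [4 + 5]; the lower one is
   at least that minus 48, and the final expected potential costs 1 more. The node [v0] already
   forces [n >= 1]. *)
exists 49, 0%N => n _ d Omega P X v0 callsX.
have nR : 1 <= n%:R :> R by rewrite ler1n (leq_ltn_trans _ (ltn_ord v0)).
have upper : (expected_spreading_time P X v0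
    <= (log2 (n%:R : R) + ln (n%:R : R) + 9)%:E)%E.
  rewrite expected_spreading_timeE//; apply: lime_le.
    by apply: is_cvg_nneseries => t _ _; rewrite lee_fin survival_ge0.
  apply: nearW => M; rewrite sumEFin lee_fin.
  apply: (le_trans (sum_survival_le _ _ _ _ callsX M)).
  rewrite /upper_potential /log2 subKr ln1 subr0 subrK.
  have : 0 <= 5 / n%:R :> R by rewrite divr_ge0.
  have : (n%:R - 1) / n%:R <= 1 :> R by rewrite ler_pdivrMr; lra.
  lra.
have lower : ((log2 (n%:R : R) + ln (n%:R : R) - 49)%:E
    <= expected_spreading_time P X v0)%E.
  have [M hM] := sum_survival_ge _ _ _ v0 callsX.
  rewrite expected_spreading_timeE//.
  apply: (@le_trans _ _ (\sum_(0 <= t < M) (survival P n X v0 t)%:E)%E).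
    rewrite sumEFin lee_fin (le_trans _ hM)//.
    rewrite /lower_potential /log2 subKr ln1 subr0 subrK.
    have : 0 <= 40 / Num.sqrt n%:R :> R by rewrite divr_ge0// sqrtr_ge0.
    have : 0 <= 1 / n%:R :> R by rewrite divr_ge0.
    lra.
  by apply: nneseries_lim_ge => t _ _; rewrite lee_fin survival_ge0.
(* The two finite bounds exclude infinite values. *)
move: upper lower; case: (expected_spreading_time P X v0) => [r| |]//.
by rewrite -EFinB abse_EFin !lee_fin => up lo; rewrite ler_norml; apply/andP; split; lra.
Qed.
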